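(* Let $p$ be an odd prime, let $\alpha,\beta$ be positive integers, and let $G = \mathbb{Z}_{p^{\alpha}}\oplus\mathbb{Z}_{p^\beta}$. Let $A=\{a\in\mathbb{N} : 1\le a\le p^{\max(\alpha,\beta)},\ \gcd(a,p)=1\}$. Then $\eta_A(G) = \alpha + \beta + 1$.
   Context: $\mathbb{Z}_n$ denotes the cyclic group $\mathbb{Z}/n\mathbb{Z}$. A sequence over a finite abelian group $G$ (written additively) is a finite list of elements of $G$, repetitions allowed, order irrelevant; its length is its number of terms, and a subsequence is obtained by choosing a subset of the indices. For a set of integers $A$, a sequence $x_1\cdots x_k$ over $G$ ($k\ge 1$) is an $A$-weighted zero-sum sequence of length $k$ if there exist $u_1,\dots,u_k\in A$ (not necessarily distinct) with $u_1x_1+\cdots+u_kx_k=0$ in $G$. If $G$ has exponent $n$, $\eta_A(G)$ is the smallest integer $\ell$ such that every sequence over $G$ of length at least $\ell$ has a nonempty $A$-weighted zero-sum subsequence of length at most $n$. The exponent of $\mathbb{Z}_{p^\alpha}\oplus\mathbb{Z}_{p^\beta}$ is $p^{\max(\alpha,\beta)}$. *)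

(* Defs.v *)
From HB Require Import structures.
From mathcomp Require Import all_boot all_order all_algebra.
From mathcomp Require Import all_fingroup all_solvable.

Set Implicit Arguments.
Unset Strict Implicit.
Unset Printing Implicit Defensive.

Import Order.TTheory GRing.Theory Num.Theory.
Local Open Scope ring_scope.

(* MathComp has the zmodType and finType instances on products, but not their
   join. *)
HB.instance Definition _ (G H : finZmodType) := GRing.Zmodule.on (G * H)%type.

Definition weighted_zero_sum (G : zmodType) (A : {pred int}) (s : seq G) : Prop :=
  (0 < size s)%N /\
  exists u : 'I_(size s) -> int,
    (forall i, u i \in A) /\ \sum_(i < size s) s`_i *~ u i = 0.

Definition eta_bound (G : finZmodType) (A : {pred int}) (l : nat) : Prop :=
  forall s : seq G, (l <= size s)%N ->
    exists t : seq G,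
      [/\ subseq t s, (size t <= exponent [set: G])%N & weighted_zero_sum A t].

(* [is_eta G A l] reads "eta_A(G) = l", including the existence of the minimum. *)
Definition is_eta (G : finZmodType) (A : {pred int}) (l : nat) : Prop :=
  eta_bound G A l /\ forall m : nat, eta_bound G A m -> (l <= m)%N.

(* Main.v *)
(* For the upper bound, let the g_i = x_i a + y_i b lie in H = <a, b>, with fewer than
   n = #{i} prime factors in |H|. A relation whose weights are 0 or prime to p is
   found by induction on n, looking at the points (x_i, y_i) mod p. Three points
   in pairwise distinct directions satisfy Cramer's relation, which holds exactly
   over the integers and has unit weights; two points in each of two directions
   are handled by adding two Cramer relations. Otherwise all points but one lie
   on a line mod p, so that after a change of basis the remaining g_i lie in
   <a', p b>. Either this is a proper subgroup of H and induction applies, or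
   H is cyclic; in the cyclic case two coefficients prime to p give a relation,
   and otherwise all g_i but one lie in <p a>. *)

Require Import Defs.
From mathcomp Require Import all_boot all_order all_algebra.
From mathcomp Require Import all_fingroup all_solvable.
From mathcomp Require Import ring zify.

Set Implicit Arguments.
Unset Strict Implicit.

Import Order.TTheory GRing.Theory Num.Theory FinRing.Theory.
Local Open Scope ring_scope.

(** * Relations with unit weights; subgroups with one or two generators *)

(** Terms outside [r] have weight 0, and the values of [c] there are irrelevant. Weights range over
    all integers prime to [p], so that determinants can serve; they are reduced into the bounded set
    [A] only at the end. *)
Definition unit_relation (p : nat) (G : zmodType) (T : eqType) (g : T -> G)
    (I : {pred T}) : Prop :=
  exists r : seq T, exists c : T -> int,
    [/\ uniq r, r != [::], {subset r <= I},
        all (fun t => ~~ (p %| c t)%Z) r & \sum_(t <- r) g t *~ c t = 0].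

Lemma Euclid_dvdzM (p : nat) (m n : int) :
  prime p -> (p %| m * n)%Z = (p %| m)%Z || (p %| n)%Z.
Proof. by move=> pp; rewrite !dvdzE abszM Euclid_dvdM. Qed.

Lemma prime_ndvdz1 (p : nat) : prime p -> ~~ (p %| 1)%Z.
Proof. by move=> pp; rewrite dvdzE Euclid_dvd1. Qed.

Lemma unit_relationS (p : nat) (G : zmodType) (T : eqType) (g : T -> G)
    (I J : {pred T}) :
  {subset I <= J} -> unit_relation p g I -> unit_relation p g J.
Proof.
move=> sIJ [r [c [ur r0 rI pr cr]]]; exists r, c; split=> // t /rI; exact: sIJ.
Qed.

Lemma logn_proper (p : nat) (gT : finGroupType) (K H : {group gT}) :
  prime p -> (p.-group H)%g -> K \proper H -> (logn p #|K| < logn p #|H|)%N.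
Proof.
move=> pp pH /[dup] /proper_card ltKH /andP[sKH _].
have pK := pgroupS sKH pH.
rewrite (card_pgroup pK) (card_pgroup pH) ltn_exp2l ?prime_gt1 // in ltKH.
Qed.

Lemma group_mulrz (G : finZmodType) (K : {group G}) (a : G) (x : int) :
  a \in K -> a *~ x \in K.
Proof.
move=> aK; case: x => n; first by rewrite -pmulrn -zmodXgE groupX.
by rewrite NegzE mulrNz -pmulrn -zmodXgE -zmodVgE groupV groupX.
Qed.

Lemma cycle_mulrzP (G : finZmodType) (a g : G) :
  reflect (exists x : int, g = a *~ x) (g \in <[a]>%g).
Proof.
apply: (iffP (cycleP a g)) => [[n ->]|[x ->]].
  by exists n%:Z; rewrite zmodXgE pmulrn.
by apply/cycleP; rewrite group_mulrz ?cycle_id.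
Qed.

Lemma span2_mulrzP (G : finZmodType) (a b g : G) :
  reflect (exists x y : int, g = a *~ x + b *~ y) (g \in <[a]> <*> <[b]>)%g.
Proof.
rewrite cent_joinEr; last first.
  by apply: sub_abelian_cent2 (subsetT _) (subsetT _); apply: zmod_abelian.
apply: (iffP mulsgP) => [[u v /cycle_mulrzP[x ->] /cycle_mulrzP[y ->] ->]|].
  by exists x, y.
move=> [x [y ->]]; exists (a *~ x) (b *~ y) => //; apply/cycle_mulrzP.
  by exists x.
by exists y.
Qed.

(** As [#|G|] is a power of [p], Bezout inverts [u] modulo [#|G|], and the inverse carries [b *~ u]
    back to [b]. The later uses take [u = 1 - p z], a Nakayama-style argument. *)
Lemma mem_unit_mulrz (p : nat) (G : finZmodType) (K : {group G}) (b : G) (u : int) :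
  prime p -> (p.-group [set: G])%g -> ~~ (p %| u)%Z -> b *~ u \in K -> b \in K.
Proof.
move=> pp pG pu buK.
have : coprimez u #|[set: G]|.
  by rewrite coprimezE (card_pgroup pG) coprimeXr // coprime_sym prime_coprime.
move=> /coprimezP[[v w] /= uv].
suff -> : b = b *~ u *~ v by rewrite group_mulrz.
rewrite -[LHS]mulr1z -uv mulrzDr [w * _]mulrC (mulrzA b #|_|) -pmulrn -zmodXgE.
by rewrite expg_cardG ?inE // zmod1gE mul0rz addr0 mulrC mulrzA.
Qed.

(** The coordinate sums vanish as integers, so the relation holds whatever relations [a] and [b]
    satisfy in [G]. *)
Lemma unit_relation_coord2 (p : nat) (G : zmodType) (T : eqType) (g : T -> G)
    (I : {pred T}) (a b : G) (x y c : T -> int) (r : seq T) :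
  {in I, forall t, g t = a *~ x t + b *~ y t} ->
  uniq r -> r != [::] -> {subset r <= I} ->
  all (fun t => ~~ (p %| c t)%Z) r ->
  \sum_(t <- r) x t * c t = 0 -> \sum_(t <- r) y t * c t = 0 ->
  unit_relation p g I.
Proof.
move=> gE ur r0 rI pr xr yr; exists r, c; split=> //.
rewrite (eq_big_seq (fun t => a *~ (x t * c t) + b *~ (y t * c t))); last first.
  by move=> t /rI/gE ->; rewrite mulrzDl !mulrzA.
by rewrite big_split -!mulrz_sumr xr yr !mulr0z; exact: addr0.
Qed.

(** * The cyclic case *)

(** Induction on [#|I|]. Two coefficients prime to [p] cancel crosswise. Otherwise dropping one term
    leaves only multiples of [a *+ p], which generates a proper subgroup when [a] is nonzero, so the
    logarithm of the order drops along with the number of terms. *)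
Lemma unit_relation_cyclic (p : nat) (G : finZmodType) (T : finType)
    (g : T -> G) (I : {set T}) (a : G) :
  prime p -> (p.-group [set: G])%g ->
  {in I, forall t, g t \in <[a]>%g} -> (logn p #[a]%g < #|I|)%N ->
  unit_relation p g I.
Proof.
move=> pp pG; have [n] := ubnP #|I|; elim: n I a => // n IH I a leIn gI ltI.
have [x gE] : exists x : T -> int, forall t, t \in I -> g t = a *~ x t.
  apply: (fin_all_exists (P := fun t z => t \in I -> g t = a *~ z)) => t.
  have [tI|] := boolP (t \in I); last by exists 0.
  by have /cycle_mulrzP[z] := gI t tI; exists z.
(* A zero second generator brings the cyclic case under [unit_relation_coord2]. *)
have gE2 : {in I, forall t, g t = a *~ x t + 0 *~ 0}.
  by move=> t /gE ->; rewrite mul0rz addr0.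
have [i0 i0I] : exists i, i \in I.
  by apply/set0Pn; rewrite -card_gt0; apply: leq_trans ltI.
have [a0|a_neq0] := eqVneq a 0.
  exists [:: i0], (fun=> 1); split=> //.
  - by move=> t; rewrite inE => /eqP ->.
  - by rewrite /= andbT prime_ndvdz1.
  - by rewrite big_seq1 mulr1z gE // a0 mul0rz.
have [i1 [i1I dvd_x]] : exists i1, i1 \in I /\ 
    ((forall t, t \in I -> t != i1 -> (p %| x t)%Z) \/
     exists2 j, j \in I /\ j != i1 & ~~ (p %| x i1)%Z && ~~ (p %| x j)%Z).
  have [/existsP[i /andP[iI pxi]]|] := boolP [exists i, (i \in I) && ~~ (p %| x i)%Z].
    exists i; split=> //.
    have [/existsP[j /and3P[jI ji pxj]]|] :=
      boolP [exists j, [&& j \in I, j != i & ~~ (p %| x j)%Z]].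
      by right; exists j => //; rewrite pxi.
    rewrite negb_exists => /forallP H; left=> t tI ti; move: (H t).
    by rewrite tI ti negbK.
  rewrite negb_exists => /forallP H; exists i0; split=> //; left=> t tI _.
  by move: (H t); rewrite tI negbK.
case: dvd_x => [dvd_x|[j [jI ji1] /andP[pi pj]]]; last first.
  apply: (@unit_relation_coord2 p G T g _ a 0 x (fun=> 0)
           (fun t => if t == i1 then x j else - x i1) [:: i1; j] gE2) => //=.
  - by rewrite inE eq_sym ji1.
  - by move=> t; rewrite !inE => /orP[] /eqP ->.
  - by rewrite eqxx (negbTE ji1) rpredN pj pi.
  - by rewrite !big_cons big_nil eqxx (negbTE ji1); ring.
  - by rewrite big1 // => t _; rewrite mul0r.
have sub : {subset I :\ i1 <= I} by move=> t /setD1P[].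
apply: unit_relationS sub _; apply: (IH _ (a *+ p)).
- by move: leIn; rewrite (cardsD1 i1) i1I.
- move=> t /setD1P[ti tI]; have /dvdzP[z xz] := dvd_x t tI ti.
  apply/cycle_mulrzP; exists z.
  by rewrite gE // xz mulrC mulrzA -pmulrn.
have cI : #|I| = #|I :\ i1|.+1 by rewrite (cardsD1 i1) i1I.
rewrite -ltnS -cI; apply: leq_trans ltI; rewrite ltnS; apply: logn_proper => //.
  exact: pgroupS (subsetT _) pG.
rewrite properE cycle_subG -zmodXgE mem_cycle /= cycle_subG.
apply/negP=> /cycle_mulrzP[z az]; case/negP: a_neq0.
(* From [a = p z a] follows [(1 - p z) a = 0], with [1 - p z] prime to [p]. *)
suff : a \in 1%G by rewrite inE.
apply: (@mem_unit_mulrz p _ _ _ (1 - p%:Z * z)) => //.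
  by rewrite rpredBr ?dvdz_mulr ?prime_ndvdz1.
rewrite inE mulrzBr mulr1z mulrzA -pmulrn {1}az zmodXgE subrr; exact: eqxx.
Qed.

(** * Cramer relations among coefficient points modulo [p] *)

Section Rank2.

Variables (p : nat) (G : finZmodType) (T : finType) (g : T -> G).
Hypothesis p_prime : prime p.

Variables (I : {set T}) (a b : G) (x y : T -> int).
Hypothesis gE : {in I, forall t, g t = a *~ x t + b *~ y t}.

Let det (i j : T) : int := x i * y j - x j * y i.

Let detC i j : det j i = - det i j.
Proof. by rewrite /det; ring. Qed.

Let dvd_detC i j : (p %| det j i)%Z = (p %| det i j)%Z.
Proof. by rewrite detC rpredN. Qed.

(** Cramer: [det j k] times point [i], minus [det i k] times point [j], plus [det i j] times point
    [k] is zero over the integers. The indices are distinct because [det t t = 0]. *)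
Lemma unit_relation_det3 (i j k : T) :
  i \in I -> j \in I -> k \in I ->
  ~~ (p %| det i j)%Z -> ~~ (p %| det i k)%Z -> ~~ (p %| det j k)%Z ->
  unit_relation p g I.
Proof.
have detii t : (p %| det t t)%Z by rewrite /det subrr rpred0.
move=> iI jI kI nij nik njk.
have ij : j != i by apply: contraNneq nij => ->.
have ik : k != i by apply: contraNneq nik => ->.
have jk : k != j by apply: contraNneq njk => ->.
apply: (unit_relation_coord2
         (c := fun t => if t == i then det j k else if t == j then - det i k
                        else det i j) (r := [:: i; j; k]) gE) => //=.
- by rewrite !inE negb_or (eq_sym i j) (eq_sym i k) (eq_sym j k) ij ik jk.
- by move=> t; rewrite !inE => /or3P[] /eqP ->.
- by rewrite !eqxx (negbTE ij) (negbTE ik) (negbTE jk) rpredN nij nik njk.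
- rewrite !big_cons big_nil !eqxx (negbTE ij) (negbTE ik) (negbTE jk) /det.
  by ring.
- rewrite !big_cons big_nil !eqxx (negbTE ij) (negbTE ik) (negbTE jk) /det.
  by ring.
Qed.

(* The weights are those of the sum of the two Cramer relations among
   [i, k, j] and among [k, j, l]. *)
Lemma unit_relation_det4 (i k j l : T) :
  i \in I -> k \in I -> j \in I -> l \in I -> k != i -> l != j ->
  (p %| det i k)%Z -> (p %| det j l)%Z ->
  ~~ (p %| det i j)%Z -> ~~ (p %| det k j)%Z -> ~~ (p %| det i l)%Z ->
  unit_relation p g I.
Proof.
have detii t : (p %| det t t)%Z by rewrite /det subrr rpred0.
move=> iI kI jI lI ki lj dik djl nij nkj nil.
have nkl : ~~ (p %| det k l)%Z.
  apply: contra nil => dkl.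
  suff : (p %| det i l * det k j)%Z by rewrite Euclid_dvdzM // (negbTE nkj) orbF.
  (* The Plücker relation; it forces [det k l] to be prime to [p]. *)
  have -> : det i l * det k j = det i j * det k l - det i k * det j l.
    by rewrite /det; ring.
  by rewrite rpredB ?dvdz_mull.
have ij : j != i by apply: contraNneq nij => ->.
have il : l != i by apply: contraNneq nil => ->.
have kj : j != k by apply: contraNneq nkj => ->.
have kl : l != k by apply: contraNneq nkl => ->.
apply: (unit_relation_coord2
         (c := fun t => if t == k then det j l - det i j
                        else if t == j then det i k - det k l
                        else det k j) (r := [:: i; k; j; l]) gE) => //=.
- rewrite !inE !negb_or (eq_sym i k) (eq_sym i j) (eq_sym i l) (eq_sym k j).
  by rewrite (eq_sym k l) (eq_sym j l) ki ij il kj kl lj.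
- by move=> t; rewrite !inE => /or4P[] /eqP ->.
(* Modulo [p] the weights of [k] and [j] reduce to [- det i j] and [- det k l]. *)
- rewrite !eqxx (eq_sym i k) (eq_sym i j) (negbTE ki) (negbTE ij) (negbTE kj) (negbTE kl).
  by rewrite (negbTE lj) (rpredBl _ djl) (rpredBl _ dik) nij nkl nkj.
- rewrite !big_cons big_nil !eqxx (eq_sym i k) (eq_sym i j) (negbTE ki) (negbTE ij).
  by rewrite (negbTE kj) (negbTE kl) (negbTE lj) /det; ring.
- rewrite !big_cons big_nil !eqxx (eq_sym i k) (eq_sym i j) (negbTE ki) (negbTE ij).
  by rewrite (negbTE kj) (negbTE kl) (negbTE lj) /det; ring.
Qed.

(** Vanishing of [l * y t - x t * m] modulo [p] puts point [t] on the line through 0 and [(l, m)].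
    Starting from an independent pair [i], [j], a third direction gives [unit_relation_det3], and a
    second point off each of the two lines gives [unit_relation_det4]. *)
Lemma unit_relation_or_line :
  I != set0 ->
  unit_relation p g I \/
  exists i l m, [/\ i \in I, ~~ ((p %| l)%Z && (p %| m)%Z)
    & {in I :\ i, forall t, (p %| l * y t - x t * m)%Z}].
Proof.
move=> /set0Pn[i0 i0I].
(* The line is spanned by point [i], nonzero modulo [p] because [det i j] is; the exceptional point
   is [j]. *)
have lineP i j : i \in I -> j \in I -> ~~ (p %| det i j)%Z ->
    {in I :\ j, forall t, (p %| det i t)%Z} ->
    exists i l m, [/\ i \in I, ~~ ((p %| l)%Z && (p %| m)%Z)
      & {in I :\ i, forall t, (p %| l * y t - x t * m)%Z}].
  move=> iI jI nij dit; exists j, (x i), (y i); split=> //.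
  apply: contra nij => /andP[dx dy].
  by apply: rpredB; [exact: dvdz_mulr | exact: dvdz_mull].
have [/existsP[i /existsP[j /and3P[iI jI nij]]]|/existsPn alldvd] :=
  boolP [exists i, exists j, [&& i \in I, j \in I & ~~ (p %| det i j)%Z]];
    last first.
  right; have {}alldvd i j : i \in I -> j \in I -> (p %| det i j)%Z.
    move=> iI jI; have /existsPn/(_ j) := alldvd i.
    by rewrite iI jI negbK.
  have [/existsP[i /andP[iI nxy]]|/existsPn all0] :=
    boolP [exists i, (i \in I) && ~~ ((p %| x i)%Z && (p %| y i)%Z)].
    exists i0, (x i), (y i); split=> // t /setD1P[_ tI]; exact: alldvd.
  (* All points vanish modulo [p], so any direction works. *)
  exists i0, 1, 0; split=> //; first by rewrite (negbTE (prime_ndvdz1 _)).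
  move=> t /setD1P[_ tI]; move: (all0 t); rewrite tI negbK => /andP[_ dy].
  by rewrite mul1r mulr0 subr0.
have [/existsP[k /and3P[kI nik njk]]|/existsPn dvd_or] :=
  boolP [exists k, [&& k \in I, ~~ (p %| det i k)%Z & ~~ (p %| det j k)%Z]].
  by left; apply: (@unit_relation_det3 i j k).
have {}dvd_or k : k \in I -> (p %| det i k)%Z || (p %| det j k)%Z.
  by move=> kI; move: (dvd_or k); rewrite kI /= negb_and !negbK.
have [/existsP[k /and3P[kI ki njk]]|/existsPn jline] :=
  boolP [exists k, [&& k \in I, k != i & ~~ (p %| det j k)%Z]]; last first.
  right; apply: (lineP j i) => // [|t /setD1P[ti tI]]; first by rewrite dvd_detC.
  by move: (jline t); rewrite tI ti negbK.
have [/existsP[l /and3P[lI lj nil]]|/existsPn iline] :=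
  boolP [exists l, [&& l \in I, l != j & ~~ (p %| det i l)%Z]]; last first.
  right; apply: (lineP i j) => // t /setD1P[tj tI].
  by move: (iline t); rewrite tI tj negbK.
left; apply: (@unit_relation_det4 i k j l) => //.
- by move: (dvd_or k kI); rewrite (negbTE njk) orbF.
- by move: (dvd_or l lI); rewrite (negbTE nil).
- by rewrite dvd_detC.
Qed.

End Rank2.

(** * Change of basis and the induction in rank two *)

(** With [w] inverse to [l] modulo [p], the slope [t = w * m] gives [v = t * u] modulo [p] on the
    line. Then [a u + b v] is [u (a + t b)] plus a multiple of [p b]. *)
Lemma mem_span2_shear (p : nat) (G : finZmodType) (a b : G) (l m : int) :
  prime p -> ~~ (p %| l)%Z ->
  exists t : int, forall u v : int, (p %| l * v - u * m)%Z ->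
    a *~ u + b *~ v \in (<[(a + b *~ t)%R]> <*> <[(b *+ p)%R]>)%g.
Proof.
move=> pp pl; have : coprimez l p by rewrite coprimez_sym coprimezE prime_coprime.
move=> /coprimezP[[w z] /= lw]; exists (w * m) => u v /dvdzP[q qE].
apply/span2_mulrzP; exists u, (w * q + z * v).
rewrite mulrzDl -mulrzA pmulrn -mulrzA -addrA -mulrzDr; congr (_ + _ *~ _).
rewrite -[LHS]mul1r -lw; apply/eqP; rewrite -subr_eq0; apply/eqP.
by transitivity (w * (l * v - u * m - q * p)); [ring | rewrite qE subrr mulr0].
Qed.

(** If [b] is outside [H'], then [H'] is proper in [H]. Otherwise [b = u (a + t b) + v p b], so
    [(1 - p v) b] lies in the cyclic group of [a + t b]; hence so does [b], and then [a]. *)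
Lemma span2_shear_drop (p : nat) (G : finZmodType) (a b : G) (t : int) :
  prime p -> (p.-group [set: G])%g ->
  let H := (<[a]> <*> <[b]>)%G in
  let H' := (<[(a + b *~ t)%R]> <*> <[(b *+ p)%R]>)%G in
  (logn p #|H'| < logn p #|H|)%N \/ H \subset <[(a + b *~ t)%R]>%g.
Proof.
move=> pp pG H H'.
have aH : a \in H by apply: (subsetP (joing_subl _ _)); exact: cycle_id.
have bH : b \in H by apply: (subsetP (joing_subr _ _)); exact: cycle_id.
have sH'H : H' \subset H.
  rewrite join_subG !cycle_subG -zmodXgE groupX // andbT.
  by rewrite -zmodMgE groupM // group_mulrz.
have [bH'|nbH'] := boolP (b \in H'); last first.
  left; apply: logn_proper (pgroupS (subsetT _) pG) _ => //.
  by rewrite properE sH'H; apply: contra nbH' => /subsetP; exact.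
right; have b_in : b \in <[(a + b *~ t)%R]>%g.
  have /span2_mulrzP[u [v bE]] := bH'.
  apply: (@mem_unit_mulrz p _ _ _ (1 - p%:Z * v)) => //.
    by rewrite rpredBr ?dvdz_mulr ?prime_ndvdz1.
  apply/cycle_mulrzP; exists u.
  by rewrite mulrzBr mulr1z mulrzA -pmulrn {1}bE addrK.
rewrite join_subG !cycle_subG b_in andbT.
rewrite -[X in X \in _](addrK (b *~ t)) -mulrNz -zmodMgE groupM ?cycle_id //.
exact: group_mulrz.
Qed.

Lemma unit_relation_rank2 (p : nat) (G : finZmodType) (T : finType)
    (g : T -> G) (I : {set T}) (a b : G) :
  prime p -> (p.-group [set: G])%g ->
  {in I, forall t, g t \in (<[a]> <*> <[b]>)%g} ->
  (logn p #|(<[a]> <*> <[b]>)%g| < #|I|)%N ->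
  unit_relation p g I.
Proof.
move=> pp pG; have [n] := ubnP #|I|; elim: n I a b => // n IH I a b leIn gI ltI.
have [xy gE] : exists xy : T -> int * int,
    {in I, forall t, g t = a *~ (xy t).1 + b *~ (xy t).2}.
  apply: (fin_all_exists (P := fun t z => t \in I -> g t = a *~ z.1 + b *~ z.2)).
  move=> t; have [tI|] := boolP (t \in I); last by exists (0, 0).
  by have /span2_mulrzP[x [y ->]] := gI t tI; exists (x, y).
have I0 : I != set0 by rewrite -card_gt0; apply: leq_trans ltI.
have [//|[i [l [m [iI nlm lineI]]]]] := unit_relation_or_line pp gE I0.
(* Stated for arbitrary generators because [a] and [b] swap roles when [p] divides [l]. *)
have shear (a' b' : G) t : (<[a']> <*> <[b']> = <[a]> <*> <[b]>)%g ->
    {in I :\ i, forall s,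
      g s \in (<[(a' + b' *~ t)%R]> <*> <[(b' *+ p)%R]>)%g} ->
    unit_relation p g I.
  move=> Hab gI'; have [ltH'|sH] := @span2_shear_drop p G a' b' t pp pG.
    have cI : #|I| = #|I :\ i|.+1 by rewrite (cardsD1 i) iI.
    have sub : {subset I :\ i <= I} by move=> s /setD1P[].
    apply: unit_relationS sub _; apply: IH gI' _; first by rewrite -ltnS -cI.
    by rewrite -ltnS -cI; apply: leq_trans ltI; rewrite ltnS -Hab.
  (* Here the span is cyclic, and all of [I] is used, the exceptional [i] included. *)
  apply: (@unit_relation_cyclic p G T g I (a' + b' *~ t)) => //.
    by move=> s /gI; rewrite -Hab => /(subsetP sH).
  apply: leq_ltn_trans ltI; apply: dvdn_leq_log => //.
  apply: cardSg; rewrite cycle_subG /= -Hab -zmodMgE groupM //.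
    by apply: (subsetP (joing_subl _ _)); exact: cycle_id.
  by apply: group_mulrz; apply: (subsetP (joing_subr _ _)); exact: cycle_id.
have [pl|pl] := boolP (p %| l)%Z; last first.
  have [t tP] := mem_span2_shear a b m pp pl.
  by apply: (shear a b t) => // s sI; rewrite gE ?tP ?lineI //; case/setD1P: sI.
have pm : ~~ (p %| m)%Z by move: nlm; rewrite pl.
have [t tP] := mem_span2_shear b a l pp pm.
apply: (shear b a t) => [|s sI]; first by rewrite joingC.
rewrite gE; last by case/setD1P: sI.
by rewrite addrC tP // -rpredN opprB mulrC (mulrC m) lineI.
Qed.

(** * From unit relations to weighted zero-sum subsequences; the upper bound *)

Lemma mulrn_Zp (n : nat) (z : 'Z_n) : (1 < n)%N -> z *+ n = 0.
Proof. by move=> n1; rewrite -mulr_natr pchar_Zp // mulr0. Qed.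

Lemma Zp_natr_eq0 (n k : nat) :
  (1 < n)%N -> (k%:R == 0 :> 'Z_n) = (n %| k)%N.
Proof. by move=> n1; rewrite -val_eqE /= val_Zp_nat. Qed.

Lemma mulrz_modz (G : zmodType) (z : G) (N : nat) (c : int) :
  z *+ N = 0 -> z *~ (c %% N)%Z = z *~ c.
Proof.
move=> zN; rewrite [in RHS](divz_eq c N) [in RHS]mulrzDr [in RHS]mulrC [in RHS]mulrzA.
by rewrite -pmulrn zN mul0rz add0r.
Qed.

(** Since [p ^ M] kills [G], weights may be reduced modulo [p ^ M]. A residue stays prime to [p],
    hence is nonzero and at least 1. *)
Lemma weighted_zero_sum_of_unit_relation (p M : nat) (G : zmodType) (s : seq G) :
  prime p -> (0 < M)%N -> (forall z : G, z *+ (p ^ M) = 0) ->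
  unit_relation p (fun i : 'I_(size s) => s`_i) predT ->
  exists2 t, subseq t s &
    weighted_zero_sum
      [pred a : int | (1 <= a <= (p ^ M)%N%:Z) && (gcdz a p%:Z == 1)] t.
Proof.
move=> pp M0 killG [r [c [ur r0 _ pr cr]]].
set N := (p ^ M)%N in killG *.
have N0 : (0 < N)%N by rewrite expn_gt0 prime_gt0.
have dvdN : (p %| N%:Z)%Z by rewrite dvdzE /= dvdn_exp.
case: r r0 => // i0 r _ in ur pr cr *.
(* Lists the indices of [r] in increasing order, so that the chosen terms form a subsequence. *)
pose e := enum [set i in i0 :: r].
have e_r : e =i i0 :: r by move=> i; rewrite mem_enum inE.
have pc i : i \in e -> ~~ (p %| (c i %% N)%Z)%Z.
  rewrite e_r => /(allP pr); apply: contra => dv.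
  by rewrite (divz_eq (c i) N) rpredD ?dvdz_mull.
exists [seq s`_i | i : 'I_(size s) <- e].
  suff sE : s = [seq s`_i | i : 'I_(size s) <- enum 'I_(size s)].
    rewrite [X in subseq _ X]sE.
    by apply: map_subseq; rewrite /e enumT; apply: filter_subseq.
  apply: (@eq_from_nth _ 0) => [|k ks]; first by rewrite size_map size_enum_ord.
  by rewrite (nth_map i0) ?nth_enum_ord ?size_enum_ord.
split.
  rewrite size_map lt0n size_eq0; case: e e_r {pc} => // /(_ i0).
  by rewrite !inE eqxx.
exists (fun k => (c (nth i0 e k) %% N)%Z); split=> [[k /=]|].
  rewrite size_map => ke; have := pc _ (mem_nth i0 ke).
  set w := c _; move=> pw; rewrite inE.
  have N0z : (0 < N%:Z :> int) by rewrite ltz_nat.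
  apply/andP; split; last first.
    by rewrite -[_ == _]/(coprimez _ _) coprimez_sym coprimezE prime_coprime.
  rewrite (ltW (ltz_pmod _ N0z)) andbT -gtz0_ge1 lt_neqAle.
  rewrite modz_ge0 ?(lt0r_neq0 N0z) // andbT; apply: contraNneq pw => <-.
  exact: rpred0.
rewrite -(big_mkord xpredT (fun k => [seq s`_(nat_of_ord i) | i <- e]`_k
   *~ (c (nth i0 e k) %% N)%Z)) size_map.
rewrite (eq_big_nat _ _ (F2 := fun k => s`_(nth i0 e k) *~ c (nth i0 e k))).
  rewrite -(big_nth i0 xpredT (fun i : 'I_(size s) => s`_i *~ c i)).
  rewrite -[RHS]cr; apply: perm_big; apply: uniq_perm => //; exact: enum_uniq.
by move=> k /andP[_ ke]; rewrite (nth_map i0) // mulrz_modz.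
Qed.
(** Makes [alpha + beta + 1] terms fit within the exponent. Oddness matters: for [p = 2] it fails at
    [M = 1] and [M = 2]. *)
Lemma ltn_double_expn (p M : nat) : prime p -> odd p -> (M.*2 < p ^ M)%N.
Proof.
move=> pp op; have p3 := odd_prime_gt2 op pp.
elim: M => // M IH; rewrite expnS doubleS.
have : (3 * p ^ M <= p * p ^ M)%N by rewrite leq_mul2r p3 orbT.
lia.
Qed.

Lemma mulrn_exponent (G : finZmodType) (z : G) : z *+ exponent [set: G] = 0.
Proof. by rewrite -zmodXgE expg_exponent ?inE. Qed.

(** Killing [(1, 1)] already forces both prime powers to divide [e]. *)
Lemma leq_expn_annihilator (p alpha beta e : nat) :
  prime p -> (0 < alpha)%N -> (0 < beta)%N -> (0 < e)%N ->
  (forall z : 'Z_(p ^ alpha) * 'Z_(p ^ beta), z *+ e = 0) ->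
  (p ^ maxn alpha beta <= e)%N.
Proof.
move=> pp a0 b0 e0 /(_ (1, 1)) e_kill.
have /(congr1 fst) := e_kill; have /(congr1 snd) := e_kill.
rewrite (raddfMn snd) (raddfMn fst) /= => /eqP.
rewrite Zp_natr_eq0; last by rewrite -(expn0 p) ltn_exp2l ?prime_gt1.
move=> dvd_b /eqP; rewrite Zp_natr_eq0.
  by move=> dvd_a; rewrite /maxn; case: ifP => _; apply: dvdn_leq.
by rewrite -(expn0 p) ltn_exp2l ?prime_gt1.
Qed.

Lemma eta_bound_upper (p alpha beta : nat) :
  prime p -> odd p -> (0 < alpha)%N -> (0 < beta)%N ->
  eta_bound ('Z_(p ^ alpha) * 'Z_(p ^ beta))%type
    [pred a : int | (1 <= a <= (p ^ maxn alpha beta)%N%:Z) && (gcdz a p%:Z == 1)]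
    (alpha + beta + 1)%N.
Proof.
move=> pp op a0 b0; set G := ('Z_(p ^ alpha) * 'Z_(p ^ beta))%type.
move=> s; set k := (alpha + beta + 1)%N => ks.
set M := maxn alpha beta.
have pX_gt1 n : (0 < n)%N -> (1 < p ^ n)%N.
  by move=> n0; rewrite -(expn0 p) ltn_exp2l ?prime_gt1.
have killG (z : G) : z *+ p ^ M = 0.
  apply/eqP; rewrite -[_ == _]/((_ == _) && (_ == _)).
  rewrite (raddfMn fst) (raddfMn snd) /=.
  rewrite /M -{1}(subnKC (leq_maxl alpha beta)) -{2}(subnKC (leq_maxr alpha beta)).
  by rewrite !expnD !mulrnA !mulrn_Zp ?pX_gt1 // !mul0rn !eqxx.
have cardG : #|[set: G]| = (p ^ (alpha + beta))%N.
  rewrite cardsT card_prod !card_ord !Zp_cast ?pX_gt1 //.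
  by rewrite expnD.
have pG : (p.-group [set: G])%g by rewrite /pgroup cardG pnatX pnat_id.
have sz : size (take k s) = k by rewrite size_takel.
have [||t st wt] := @weighted_zero_sum_of_unit_relation p M G (take k s) pp _ killG.
- by rewrite leq_max a0.
- apply: (@unit_relationS p G _ _ [set: 'I_(size (take k s))]) => //.
  apply: (@unit_relation_rank2 p G _ _ _ (1, 0) (0, 1)) => // [i _|].
    set z := _`_i.
    apply/span2_mulrzP; exists (z.1 : nat)%:Z, (z.2 : nat)%:Z.
    rewrite -!pmulrn; apply/eqP; rewrite -[_ == _]/((_ == _) && (_ == _)) /=.
    rewrite !(raddfMn fst) !(raddfMn snd) /= !mul0rn addr0 add0r.
    by rewrite !natr_Zp !eqxx.
  rewrite cardsT card_ord sz /k addn1 ltnS -[X in (_ <= X)%N](pfactorK _ pp).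
  by rewrite -cardG; apply: dvdn_leq_log => //; apply: cardSg (subsetT _).
exists t; split=> //; first by apply: subseq_trans st _; apply: take_subseq.
(* The chain is [size t <= alpha + beta + 1 <= 2 M + 1 <= p ^ M <= exponent]. *)
have := leq_expn_annihilator pp a0 b0 (exponent_gt0 _) (@mulrn_exponent G).
apply: leq_trans.
apply: leq_trans (size_subseq st) _; rewrite sz /k addn1.
apply: (leq_trans _ (ltn_double_expn M pp op)); rewrite ltnS -addnn.
by rewrite leq_add ?leq_maxl ?leq_maxr.
Qed.

(** * The lower bound *)

(** Multiplying by [p ^ (n - k.+1)] kills every [v i] and turns the leading term into [p ^ n.-1]
    times [u0], nonzero modulo [p ^ n]. *)
Lemma Zp_leading_term_neq0 (p n k m : nat) (v : 'I_m -> 'Z_(p ^ n)) (u0 : int)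
    (u : 'I_m -> int) :
  prime p -> (k < n)%N -> ~~ (p %| u0)%Z ->
  (forall i, v i *+ p ^ (n - k.+1) = 0) ->
  (p ^ k)%:R *~ u0 + \sum_i v i *~ u i != 0.
Proof.
move=> pp kn pu vk; apply: contraNneq pu => /(congr1 ( *%R^~ (p ^ (n - k.+1))%:R)).
rewrite mul0r mulrDl mulr_suml big1 ?addr0; last first.
  by move=> i _; rewrite mulr_natr pmulrn mulrzAC -pmulrn vk mul0rz.
have n0 : (0 < n)%N by apply: leq_ltn_trans kn.
have N1 : (1 < p ^ n)%N by rewrite -(expn0 p) ltn_exp2l ?prime_gt1.
rewrite mulr_natr pmulrn mulrzAC -pmulrn -mulrnA -expnD.
have -> : (k + (n - k.+1) = n.-1)%N by lia.
move=> /eqP pu.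
have {pu} : ((p ^ n.-1)%:R *+ `|u0|%N : 'Z_(p ^ n)) == 0.
  case: u0 pu => d //=; rewrite NegzE mulrNz oppr_eq0 => /eqP <-.
  by rewrite pmulrn.
rewrite -mulrnA Zp_natr_eq0 // -{1}(prednK n0) expnSr dvdn_pmul2l //.
by rewrite expn_gt0 prime_gt0.
Qed.

(* The extremal sequence (1,0), (p,0), ..., (0,1), (0,p), ... : in a weighted
   sum the first term present has the least valuation in its coordinate. *)
Definition prime_power_term (p alpha beta k : nat) :
    ('Z_(p ^ alpha) * 'Z_(p ^ beta))%type :=
  if (k < alpha)%N then ((p ^ k)%:R, 0) else (0, (p ^ (k - alpha))%:R).

Lemma eta_bound_lower (p alpha beta m : nat) :
  prime p ->
  eta_bound ('Z_(p ^ alpha) * 'Z_(p ^ beta))%type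
    [pred a : int | (1 <= a <= (p ^ maxn alpha beta)%N%:Z) && (gcdz a p%:Z == 1)]
    m -> (alpha + beta + 1 <= m)%N.
Proof.
move=> pp eta_m; rewrite addn1 ltnNge; apply/negP => le_m.
pose F := prime_power_term p alpha beta.
have [|t [/subseqP[w _ ->] _]] := eta_m [seq F k | k <- iota 0 (alpha + beta)].
  by rewrite size_map size_iota.
rewrite -map_mask; set e := mask _ _.
have sub_e : subseq e (iota 0 (alpha + beta)) by apply: mask_subseq.
have : sorted ltn e := subseq_sorted ltn_trans sub_e (iota_ltn_sorted _ _).
have lt_e : {in e, forall k, (k < alpha + beta)%N}.
  by move=> k /(mem_subseq sub_e); rewrite mem_iota.
case: e lt_e {sub_e} => [|k e] lt_e; first by move=> _ [].
rewrite /= (path_sortedE ltn_trans) => /andP[/allP /= k_min _] [_ [u [uA]]].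
have pu : ~~ (p %| u ord0)%Z.
  have /andP[_] := uA ord0; rewrite -[_ == _]/(coprimez _ _) coprimez_sym.
  by rewrite coprimezE prime_coprime.
have nthF (i : 'I_(size (map F e))) : exists2 j, (k < j < alpha + beta)%N &
    (map F e)`_i = F j.
  have ie : (i < size e)%N by rewrite -(size_map F).
  have je := mem_nth 0%N ie.
  exists (nth 0%N e i); last by rewrite (nth_map 0%N).
  by rewrite k_min //= lt_e // inE je orbT.
rewrite big_ord_recl /=; under eq_bigr do rewrite add0n /=.
have kab : (k < alpha + beta)%N by apply: lt_e; rewrite mem_head.
(* The smallest index [k] heads the subsequence; the sum is projected to the coordinate where [F k]
   is nonzero. *)
case: (ltnP k alpha) => ka.
  move/(congr1 (fun z => z.1)); rewrite (raddfD fst) (raddfMz fst) raddf_sum.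
  under eq_bigr do rewrite (raddfMz fst).
  rewrite {1}/F /prime_power_term ka /=; apply/eqP.
  apply: Zp_leading_term_neq0 => // i.
  have [j /andP[kj jab] ->] := nthF i; rewrite /F /prime_power_term.
  case: ifP => [ja /=|_]; last exact: mul0rn.
  rewrite -mulrnA -expnD; apply/eqP; rewrite Zp_natr_eq0.
    by apply: dvdn_exp2l; lia.
  by rewrite -(expn0 p) ltn_exp2l ?prime_gt1 //; lia.
(* Every later index is now in the second block too, with exponents shifted by [alpha]. *)
move/(congr1 (fun z => z.2)); rewrite (raddfD snd) (raddfMz snd) raddf_sum.
under eq_bigr do rewrite (raddfMz snd).
rewrite {1}/F /prime_power_term ltnNge ka /=; apply/eqP.
apply: Zp_leading_term_neq0 => // [|i]; first by lia.
have [j /andP[kj jab] ->] := nthF i; rewrite /F /prime_power_term.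
rewrite ltnNge (leq_trans ka (ltnW kj)) /=.
rewrite -mulrnA -expnD; apply/eqP; rewrite Zp_natr_eq0.
  by apply: dvdn_exp2l; lia.
by rewrite -(expn0 p) ltn_exp2l ?prime_gt1 //; lia.
Qed.

Unset Implicit Arguments.

Theorem theorem6p1 (p alpha beta : nat)
    (p_prime : prime p) (p_odd : odd p)
    (alpha_gt0 : (0 < alpha)%N) (beta_gt0 : (0 < beta)%N) :
  is_eta ('Z_(p ^ alpha) * 'Z_(p ^ beta))%type
    [pred a : int | (1 <= a <= (p ^ maxn alpha beta)%N%:Z) && (gcdz a p%:Z == 1)]
    (alpha + beta + 1)%N.
Proof.
split; first exact: eta_bound_upper.
by move=> m; apply: eta_bound_lower.
Qed.
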